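(* For $n\in\mathbb{N}$: (i) If $n$ is composite, then $\delta(\mathcal{G}(\mathbb{Z}_n))=\phi(n)+1+\delta(\widetilde{\mathcal{G}}(\mathbb{Z}_n))$; consequently $\delta(\mathcal{G}(\mathbb{Z}_n))\ge\phi(n)+1$. (ii) $\delta(\mathcal{G}(\mathbb{Z}_n))=\phi(n)+1$ if and only if $n=2p$ for some prime $p\ge 3$.
   Context: $\mathbb{Z}_n$ is the additive group of integers modulo $n$; $\phi$ is Euler's phi function. The power graph $\mathcal{G}(G)$ of a group $G$ has vertex set $G$, distinct $u,v$ adjacent iff one is a positive integer power (multiple) of the other. $\delta$ denotes minimum degree. $\mathcal{S}(\mathbb{Z}_n)=\{\overline{0}\}\cup\{\overline{a}:1\le a<n,\gcd(a,n)=1\}$ (identity together with the generators), and $\widetilde{\mathcal{G}}(\mathbb{Z}_n)$ is the graph obtained from $\mathcal{G}(\mathbb{Z}_n)$ by deleting the vertices in $\mathcal{S}(\mathbb{Z}_n)$.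
   Formalization: Part (ii) is stated for n ≠ 4: the power graph of Z_4 is complete, so its minimum degree is 3 = φ(4)+1, although 4 is not 2p with p ≥ 3 prime, and the printed equivalence fails there. *)

(* Defs.v *)
From mathcomp Require Import all_boot all_order all_fingroup all_algebra.
From mathcomp Require Import boolp.

Set Implicit Arguments.
Unset Strict Implicit.
Unset Printing Implicit Defensive.

(* A finite simple graph: the vertices are the elements of vertices G, and only
   the restriction of adj G to that set is relevant. *)
Record sgraph (T : finType) := SGraph {
  vertices : {set T};
  adj : rel T;
  adj_sym : symmetric adj;
  adj_irr : irreflexive adj }.

Section Graphs.

Variable T : finType.
Implicit Type G : sgraph T.

Definition degree G (v : T) : nat := #|[set u in vertices G | adj G v u]|.

(* Every degree is smaller than #|vertices G|, so the neutral element of the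
   iterated minimum is irrelevant as soon as G has a vertex. *)
Definition min_degree G : nat :=
  \big[minn/#|vertices G|]_(v in vertices G) degree G v.

Definition delete_vertices G (S : {set T}) : sgraph T :=
  SGraph (vertices G :\: S) (@adj_sym _ G) (@adj_irr _ G).

End Graphs.

Section PowerGraph.

Variable gT : finGroupType.

Definition positive_power (x y : gT) : Prop :=
  exists2 k : nat, 0 < k & y = (x ^+ k)%g.

Definition power_adj : rel gT := fun x y =>
  (x != y) && `[< positive_power x y \/ positive_power y x >].

Lemma power_adj_sym : symmetric power_adj.
Proof.
move=> x y; rewrite /power_adj eq_sym; congr (_ && _).
by apply: asbool_equiv_eq; split; case; [right | left | right | left].
Qed.

Lemma power_adj_irr : irreflexive power_adj.
Proof. by move=> x; rewrite /power_adj eqxx. Qed.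

Definition power_graph (A : {group gT}) : sgraph gT :=
  SGraph A power_adj_sym power_adj_irr.

End PowerGraph.

(* Zp n is the additive group of integers modulo n for every n > 0; unlike the
   type 'Z_n, it is the trivial group when n = 1. Its group law is addition, so
   (x ^+ k)%g is the k-th multiple of x. *)
Definition power_graph_Zn (n : nat) : sgraph 'Z_n := power_graph (Zp_group n).

Definition zero_and_generators (n : nat) : {set 'Z_n} :=
  [set a in Zp n | (a == 0%R) || [&& 1 <= a, a < n & coprime a n]].

Definition reduced_power_graph_Zn (n : nat) : sgraph 'Z_n :=
  delete_vertices (power_graph_Zn n) (zero_and_generators n).

Definition composite (n : nat) : bool := (1 < n) && ~~ prime n.

(* The power graph of the integers modulo 4 is complete and totient 4 = 2, so
   the characterization of min_degree (power_graph_Zn n) = totient n + 1 by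
   n = 2p with p >= 3 prime needs n <> 4. *)
Lemma min_degree_power_graph_Z4 :
  min_degree (power_graph_Zn 4) = totient 4 + 1.
Proof.
have gen (x y : 'Z_4) k : 0 < k -> y = (x ^+ k)%g -> positive_power x y.
  by exists k.
have complete (x y : 'Z_4) : x != y -> power_adj x y.
  move=> xy; rewrite /power_adj xy; apply/asboolP.
  case: x xy => [[|[|[|[|//]]]] ?]; case: y => [[|[|[|[|//]]]] ?] // _;
  by first [ left; apply: (@gen _ _ 2); [| apply: val_inj; rewrite Zp_expg]; done
           | left; apply: (@gen _ _ 3); [| apply: val_inj; rewrite Zp_expg]; done
           | left; apply: (@gen _ _ 4); [| apply: val_inj; rewrite Zp_expg]; done
           | right; apply: (@gen _ _ 2); [| apply: val_inj; rewrite Zp_expg]; done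
           | right; apply: (@gen _ _ 4); [| apply: val_inj; rewrite Zp_expg]; done].
have deg3 v : v \in vertices (power_graph_Zn 4) -> degree (power_graph_Zn 4) v = 3.
  move=> vV; apply: (@etrans _ _ #|Zp 4 :\ v|); last first.
    by have := cardsD1 v (Zp 4); rewrite vV card_Zp // => -[].
  apply: eq_card => u; rewrite !inE /= andbC.
  have [-> | uv] := eqVneq u v; first by rewrite power_adj_irr.
  by rewrite complete // eq_sym.
by rewrite /min_degree (eq_bigr _ deg3) card_Zp // big_const card_Zp //.
Qed.

(* Main.v *)
(** The identity and the generators are adjacent to every other vertex, so
    deleting them lowers every remaining degree by exactly [totient n + 1].
    Equality in (ii) therefore means that the reduced graph has an isolated
    vertex [v].  Since [v^-1] is adjacent to [v] unless equal to it, [v] is the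
    involution of the cyclic group, and [v] lies in the subgroup of order [2q]
    for each prime [q] dividing [n/2]; this subgroup must be the whole group. *)
Require Import Defs.
From mathcomp Require Import all_boot all_order all_fingroup all_algebra.
From mathcomp Require Import cyclic boolp.

Set Implicit Arguments.
Unset Strict Implicit.
Unset Printing Implicit Defensive.

(** * Minimum degree of a finite graph and deletion of universal vertices *)

Section MinDegree.

Variable T : finType.
Implicit Types (G : sgraph T) (S : {set T}) (v : T).

Lemma min_degree_leq G v : v \in vertices G -> min_degree G <= degree G v.
Proof.
rewrite /min_degree => vG; have: v \in index_enum T by rewrite mem_index_enum.
elim: (index_enum T) => // x r IHr; rewrite inE big_cons => /predU1P[<- | v_r].
  by rewrite vG geq_minl.
by case: ifP => _; rewrite ?geq_min IHr ?orbT.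
Qed.

Lemma degree_ltn G v : v \in vertices G -> degree G v < #|vertices G|.
Proof.
move=> vG; apply/proper_card/properP; split.
  by apply/subsetP=> u; rewrite inE => /andP[].
by exists v; rewrite // inE adj_irr andbF.
Qed.

Lemma min_degree_ltn G v :
  v \in vertices G -> min_degree G < #|vertices G|.
Proof. by move=> vG; apply: leq_ltn_trans (min_degree_leq vG) (degree_ltn vG). Qed.

(** The vertex [v] takes care of the neutral element of the iterated minimum:
    [m <= degree G v < #|vertices G|]. *)
Lemma leq_min_degree G v m : v \in vertices G ->
  (forall u, u \in vertices G -> m <= degree G u) -> m <= min_degree G.
Proof.
move=> vG le_m; have le_mV: m <= #|vertices G|.
  exact: leq_trans (le_m v vG) (ltnW (degree_ltn vG)).
by rewrite /min_degree; elim/big_ind: _ => // x y mx my; rewrite leq_min mx.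
Qed.

Lemma min_degree_attained G v : v \in vertices G ->
  exists2 u, u \in vertices G & min_degree G = degree G u.
Proof.
move=> vG; case: (arg_minnP (degree G) vG) => u uG u_min; exists u => //.
by apply/eqP; rewrite eqn_leq min_degree_leq //= (leq_min_degree uG).
Qed.

Definition universal_set G S := forall u v,
  u \in S -> v \in vertices G -> u != v -> adj G u v.

(** As [v] lies outside [S], its neighbours inside [S] are all of [S]; those outside are its
    neighbours after deletion. *)
Lemma degree_delete_universal G S v : S \subset vertices G ->
    universal_set G S -> v \in vertices (delete_vertices G S) ->
  degree G v = #|S| + degree (delete_vertices G S) v.
Proof.
move=> sSG univS; rewrite inE => /andP[vNS vG].
rewrite /degree -(cardsID S); congr (_ + _); apply: eq_card => u.
  rewrite !inE; case uS: (u \in S); rewrite ?andbF //= andbT (subsetP sSG) //=.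
  by rewrite adj_sym univS //; apply: contraNneq vNS => <-.
by rewrite !inE andbA.
Qed.

(** Surviving vertices all lose [#|S|] neighbours, and vertices of [S] have maximal degree, so they
    cannot lower the minimum. Properness provides a survivor [w], so the reduced minimum is
    attained. *)
Lemma min_degree_delete_universal G S : S \proper vertices G ->
    universal_set G S ->
  min_degree G = #|S| + min_degree (delete_vertices G S).
Proof.
move=> /properP[sSG [w wG wNS]] univS.
have wG' : w \in vertices (delete_vertices G S) by rewrite inE wNS.
apply/eqP; rewrite eqn_leq; apply/andP; split.
  have [u uG' ->] := min_degree_attained wG'.
  rewrite -(degree_delete_universal sSG univS uG') min_degree_leq //.
  by move: uG'; rewrite inE => /andP[].
apply: (leq_min_degree wG) => u uG; case uS: (u \in S); last first.
  have uG' : u \in vertices (delete_vertices G S) by rewrite inE uS.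
  by rewrite (degree_delete_universal sSG univS uG') leq_add2l min_degree_leq.
(* A universal vertex has degree [#|vertices G| - 1], the largest possible. *)
have max_u : degree G w <= degree G u.
  have := degree_ltn wG; rewrite (cardsD1 u) uG add1n ltnS.
  move/leq_trans; apply; apply/subset_leq_card/subsetP=> x.
  by rewrite !inE => /andP[xu xG]; rewrite xG univS // eq_sym.
apply: leq_trans max_u; rewrite (degree_delete_universal sSG univS wG').
by rewrite leq_add2l min_degree_leq.
Qed.

Lemma min_degree_eq0 G v : v \in vertices G -> min_degree G = 0 ->
  exists2 u, u \in vertices G & forall x, x \in vertices G -> ~~ adj G u x.
Proof.
move=> vG; have [u uG ->] := min_degree_attained vG => /cards0_eq Nu0.
exists u => // x xG; apply/negP=> ux.
by have := in_set0 x; rewrite -Nu0 inE xG ux.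
Qed.

Lemma isolated_min_degree G v : v \in vertices G ->
  (forall x, x \in vertices G -> ~~ adj G v x) -> min_degree G = 0.
Proof.
move=> vG isol; apply/eqP; rewrite -leqn0 (leq_trans (min_degree_leq vG)) //.
rewrite leqn0 cards_eq0; apply/eqP/setP=> x; rewrite !inE.
by apply/negP=> /andP[/isol/negPf->].
Qed.

End MinDegree.

(** * Power graphs of finite cyclic groups *)

Section CyclicPowerGraph.

Local Open Scope group_scope.

Variable gT : finGroupType.
Implicit Types (x y : gT) (A : {group gT}).

Lemma positive_powerP x y : positive_power x y <-> y \in <[x]>.
Proof.
split=> [[k _ ->] | /cycleP[k ->]]; first exact: mem_cycle.
(* Adding the order of [x] makes the exponent positive without changing the power. *)
exists (k + #[x])%N; first by rewrite addn_gt0 order_gt0 orbT.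
by rewrite expgD expg_order mulg1.
Qed.

Lemma power_adjE x y :
  power_adj x y = (x != y) && ((y \in <[x]>) || (x \in <[y]>)).
Proof.
rewrite /power_adj; congr (_ && _); apply/asboolP/orP.
  by case=> /positive_powerP ?; [left | right].
by case=> /positive_powerP ?; [left | right].
Qed.

Definition identity_and_generators A := 1 |: [set x | generator A x].

Lemma identity_and_generators_sub A : identity_and_generators A \subset A.
Proof.
apply/subsetP=> x; rewrite !inE => /predU1P[-> // | /eqP->].
exact: cycle_id.
Qed.

Lemma identity_and_generators_universal A :
  universal_set (power_graph A) (identity_and_generators A).
Proof.
move=> x y xS yA xy; rewrite /= power_adjE xy /=; move: xS; rewrite !inE.
by case/predU1P=> [-> | /eqP <-]; rewrite ?group1 ?orbT ?yA.
Qed.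

(** Since [<[x]>] lies in [A], it equals [A] as soon as the cardinals agree; from here on membership
    is decided by orders alone. *)
Lemma mem_identity_and_generators A x : x \in A ->
  (x \in identity_and_generators A) = (#[x] == 1)%N || (#[x] == #|A|).
Proof.
move=> xA; rewrite !inE order_eq1; congr (_ || _).
have ox : #[x] <= #|A| by apply: subset_leq_card; rewrite cycle_subG.
by rewrite /generator eq_sym eqEcard cycle_subG xA eqn_leq ox.
Qed.

Lemma card_identity_and_generators A : cyclic A -> 1 < #|A| ->
  #|identity_and_generators A| = (totient #|A| + 1)%N.
Proof.
move=> /cyclicP[a defA] A_gt1; rewrite cardsU1 inE addnC; congr (_ + _)%N.
  by rewrite {2}defA -orderE totient_gen -defA.
(* The identity is not a generator, since [A] is nontrivial, so it is counted separately. *)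
rewrite /generator cycle1; case: eqP => // A1.
by rewrite A1 cards1 in A_gt1.
Qed.

Lemma cyclic_elt_order A d : cyclic A -> d %| #|A| ->
  exists2 x, x \in A & #[x] = d.
Proof.
move=> /cyclicP[a defA] /dvdnP[k kd]; exists (a ^+ k).
  by rewrite defA mem_cycle.
have oa : #[a] = #|A| by rewrite defA.
have k_gt0 : (0 < k)%N by have := cardG_gt0 A; rewrite kd; case: (k).
by rewrite orderXdiv oa kd ?dvdn_mulr // mulKn.
Qed.

(** An element whose order is the least prime factor of [#|A|] is neither trivial nor, as [#|A|] is
    not prime, a generator. *)
Lemma identity_and_generators_proper A : cyclic A -> composite #|A| ->
  identity_and_generators A \proper A.
Proof.
move=> cycA /andP[A_gt1 A_nprime].
have [x xA ox] := cyclic_elt_order cycA (pdiv_dvd #|A|).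
apply/properP; split; first exact: identity_and_generators_sub.
exists x => //; rewrite mem_identity_and_generators // ox.
have pr_p := pdiv_prime A_gt1; apply/norP; split.
  by rewrite gtn_eqF // prime_gt1.
by apply: contraNneq A_nprime => <-.
Qed.

(** In a cyclic group, inclusion of subgroups is divisibility of their orders. *)
Lemma cyclic_mem_cycle A x y : cyclic A -> x \in A -> y \in A ->
  (y \in <[x]>) = (#[y] %| #[x]).
Proof.
by move=> cycA xA yA; rewrite -cycle_subG -(cardSg_cyclic cycA) ?cycle_subG.
Qed.

Definition reduced_power_graph A :=
  delete_vertices (power_graph A) (identity_and_generators A).

Lemma min_degree_power_graph_cyclic A : cyclic A -> composite #|A| ->
  min_degree (power_graph A)
    = (totient #|A| + 1 + min_degree (reduced_power_graph A))%N.
Proof.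
move=> cycA compA; have /andP[A_gt1 _] := compA.
rewrite -(card_identity_and_generators cycA) //.
apply: min_degree_delete_universal; first exact: identity_and_generators_proper.
exact: identity_and_generators_universal.
Qed.

Lemma isolated_reduced_power_graph A v : cyclic A ->
    v \in vertices (reduced_power_graph A) ->
    (forall x, x \in vertices (reduced_power_graph A) -> ~~ power_adj v x) ->
  exists2 p, prime p & #|A| = (2 * p)%N.
Proof.
move=> cycA; rewrite inE => /andP[vNS vA] isol.
have:= vNS; rewrite mem_identity_and_generators // => /norP[v_neq1 v_ngen].
have ov : #[v] = 2.
  apply/eqP; rewrite eqn_leq order_gt1 -order_eq1 v_neq1 andbT.
  have Vv : v^-1 \in vertices (reduced_power_graph A).
    rewrite inE groupV vA andbT mem_identity_and_generators ?groupV //.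
    by rewrite orderV negb_or v_neq1.
  have := isol _ Vv; rewrite power_adjE groupV cycle_id orTb andbT negbK => /eqP vV.
  by apply: dvdn_leq => //; rewrite order_dvdn expgS expg1 {1}vV mulVg.
have [m oA] : exists m, #|A| = (2 * m)%N.
  by have /dvdnP[m oA] := order_dvdG vA; exists m; rewrite oA ov mulnC.
(* If [m] were 1, the involution [v] would generate [A]. *)
have m_gt1 : (1 < m)%N.
  by have := cardG_gt0 A; move: v_ngen; rewrite ov oA; case: (m) => [|[|]].
set p := pdiv m; have pr_p : prime p by apply: pdiv_prime.
exists p => //; apply/eqP; apply: contraT => neq_p.
have p2A : (2 * p)%N %| #|A| by rewrite oA dvdn_pmul2l // pdiv_dvd.
(* If [#|A|] is not [2 * p], an element [x] of order [2 * p] survives the deletion and [<[x]>]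
   contains [v]; isolation then forces [v = x], although their orders differ. *)
have [x xA ox] := cyclic_elt_order cycA p2A.
have p2_gt2 : (2 < 2 * p)%N by rewrite -[ltnLHS]muln1 ltn_pmul2l ?prime_gt1.
have Vx : x \in vertices (reduced_power_graph A).
  rewrite inE xA andbT mem_identity_and_generators // ox negb_or eq_sym.
  by rewrite ltn_eqF ?(ltn_trans _ p2_gt2) // eq_sym.
have := isol _ Vx; rewrite power_adjE (cyclic_mem_cycle cycA xA vA) ox ov.
rewrite dvdn_mulr // orbT andbT negbK => /eqP vx.
by move: p2_gt2; rewrite -ox -vx ov.
Qed.

(** The involution [v] is isolated. A neighbour [x] outside [<[v]>] would have order [2 * k] with
    [k] dividing [p]: [k = 1] puts [x] into [<[v]>], and [k = p] makes it a generator. *)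
Lemma min_degree_reduced_power_graph_2p A p : cyclic A -> prime p ->
  #|A| = (2 * p)%N -> min_degree (reduced_power_graph A) = 0.
Proof.
move=> cycA pr_p oA.
have [|v vA ov] := @cyclic_elt_order A 2 cycA; first by rewrite oA dvdn_mulr.
have Vv : v \in vertices (reduced_power_graph A).
  rewrite inE vA andbT mem_identity_and_generators // ov oA negb_or /=.
  by rewrite -[eqbLHS]muln1 eqn_pmul2l // ltn_eqF ?prime_gt1.
apply: (isolated_min_degree Vv) => x; rewrite inE => /andP[xNS xA].
move: xNS; rewrite mem_identity_and_generators // => /norP[x_neq1 x_ngen].
have isol : x \notin <[v]> :\ v.
  apply: contraNN x_neq1; rewrite (cycle2g ov) order_eq1 !inE.
  by case/andP=> /negPf->; rewrite orbF.
rewrite /= power_adjE; apply: contraNN isol => /andP[vx]; rewrite !inE eq_sym vx /=.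
case/orP=> //; rewrite (cyclic_mem_cycle cycA xA vA) ov => /dvdnP[k ok].
have : #[x] %| #|A| by rewrite order_dvdG.
rewrite ok oA mulnC dvdn_pmul2l //; case/primeP: pr_p => _ pr /pr/orP[]/eqP k1.
  by rewrite (cyclic_mem_cycle cycA vA xA) ok ov k1.
by move: x_ngen; rewrite ok k1 oA mulnC eqxx.
Qed.

(** The minimum degree is below [#|A|], which is at most [totient #|A| + 1] when it is 1 or prime.
    Hence equality in (ii) forces a composite order. *)
Lemma min_degree_power_graph_noncomposite A : ~~ composite #|A| ->
  min_degree (power_graph A) < totient #|A| + 1.
Proof.
rewrite negb_and negbK => ncA.
apply: leq_trans (@min_degree_ltn _ (power_graph A) 1 (group1 A)) _ => /=.
case/orP: ncA => [|pr_A]; last by rewrite totient_prime // addn1 prednK ?cardG_gt0.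
by rewrite -leqNgt => A_le1; rewrite (leq_trans A_le1) // addn1.
Qed.

Lemma min_degree_power_graph_cyclic_eq A : cyclic A -> #|A| <> 4 ->
  (min_degree (power_graph A) = (totient #|A| + 1)%N
   <-> exists p : nat, [/\ prime p, 3 <= p & #|A| = (2 * p)%N]).
Proof.
move=> cycA neq4; split=> [degA | [p [pr_p p_ge3 oA]]].
  have compA : composite #|A|.
    by apply: contraT => /min_degree_power_graph_noncomposite; rewrite degA ltnn.
  have /properP[_ [w wA wNS]] := identity_and_generators_proper cycA compA.
  have Vw : w \in vertices (reduced_power_graph A) by rewrite inE wNS.
  have [|v Vv isol] := min_degree_eq0 Vw.
    have := min_degree_power_graph_cyclic cycA compA; rewrite degA.
    by rewrite -[LHS]addn0 => /addnI.
  have [p pr_p oA] := isolated_reduced_power_graph cycA Vv isol.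
  (* The remaining prime [p = 2] would give order 4. *)
  exists p; split=> //; rewrite ltn_neqAle prime_gt1 // andbT.
  by apply/eqP=> p2; apply: neq4; rewrite oA -p2.
rewrite min_degree_power_graph_cyclic //.
  by rewrite (min_degree_reduced_power_graph_2p cycA pr_p oA) addn0.
rewrite /composite oA; apply/andP; split.
  by rewrite (@leq_pmulr 2) ?prime_gt0.
(* The divisor 2 is neither 1 nor [2 * p]. *)
apply/negP=> /primeP[_ /(_ 2 (dvdn_mulr _ (dvdnn 2)))] /=.
by rewrite -[X in X == _]muln1 eqn_pmul2l // ltn_eqF ?prime_gt1.
Qed.

End CyclicPowerGraph.

(** * Transfer to the integers modulo [n] *)

Lemma cyclic_Zp n : cyclic (Zp n).
Proof.
rewrite /Zp; case: ifP => _; last exact: cyclic1.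
by apply/cyclicP; exists Zp1; rewrite Zp_cycle.
Qed.

Lemma generator_Zp n (x : 'Z_n) : 1 < n -> generator (Zp n) x = coprime x n.
Proof.
move=> n_gt1; rewrite /Zp n_gt1 Zp_cycle.
(* The residue [x] is the [x]-th multiple of 1, which has order [n]. *)
have defx : x = (Zp1 ^+ x)%g by rewrite Zp_expg mul1n valZpK.
rewrite [in LHS]defx generator_coprime order_Zp1 coprime_sym.
by congr coprime; apply: Zp_cast.
Qed.

(** The bounds [1 <= a < n] hold for the representative of any nonzero residue, so coprimality alone
    singles out the generators. *)
Lemma zero_and_generatorsE n : 1 < n ->
  zero_and_generators n = identity_and_generators (Zp_group n).
Proof.
move=> n_gt1; apply/setP=> x; rewrite !inE /= generator_Zp //.
have -> : x \in Zp n by rewrite /Zp n_gt1 inE.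
rewrite /=; have [// | x_neq0] := eqVneq x 0%R.
have -> : x < n by rewrite -[ltnRHS](Zp_cast n_gt1) ltn_ord.
by rewrite lt0n x_neq0.
Qed.

Theorem theorem4p4 (n : nat) (n_gt0 : 0 < n) :
  (composite n ->
     min_degree (power_graph_Zn n)
       = totient n + 1 + min_degree (reduced_power_graph_Zn n)
     /\ totient n + 1 <= min_degree (power_graph_Zn n))
  /\
  (n <> 4 ->
     (min_degree (power_graph_Zn n) = totient n + 1
      <-> exists p : nat, [/\ prime p, 3 <= p & n = 2 * p])).
Proof.
have cycZ := cyclic_Zp n; have oZ := card_Zp n_gt0.
split=> [comp_n | neq4].
  suff degE : min_degree (power_graph_Zn n)
                = totient n + 1 + min_degree (reduced_power_graph_Zn n).
    by split; rewrite // degE leq_addr.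
  have /andP[n_gt1 _] := comp_n.
  rewrite /reduced_power_graph_Zn zero_and_generatorsE //.
  by have := @min_degree_power_graph_cyclic _ (Zp_group n) cycZ; rewrite oZ; apply.
by have := @min_degree_power_graph_cyclic_eq _ (Zp_group n) cycZ; rewrite oZ; apply.
Qed.
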